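(* For each positive integer $e$ there exists $N$ such that for all integers $n > N$, \[ \mathcal C_e(\mathsf U_n) = \left\{ \left(\overline{a_2}^{(e)},\overline{a_3}^{(e)},\dots,\overline{a_e}^{(e)}\right) : a_i \in \mathbb Z \text{ and } 2^{i-1} \text{ divides } a_i \text{ for each } i = 2,\dots,e \right\}. \]
   Context: For $a\in\mathbb Z$ and a positive integer $e$, $\overline{a}^{(e)}$ denotes the residue class of $a$ modulo $2^e$. $\mathsf U_n$ is the set of $n\times n$ matrices with all entries in $\{1,-1\}$ and all diagonal entries equal to $1$. For a set $\mathsf M_n$ of $n\times n$ integer matrices, $\mathcal C_e(\mathsf M_n)$ is the set of tuples $\left(\overline{a_2}^{(e)},\dots,\overline{a_e}^{(e)}\right)$ such that $\det(xI-M)=\sum_{i=0}^n a_i x^{n-i}$ for some $M\in\mathsf M_n$ (with $a_i:=0$ for $i>n$). *)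

(* Defs.v *)
From mathcomp Require Import all_boot all_algebra.
From mathcomp Require Import boolp classical_sets.

Set Implicit Arguments.
Unset Strict Implicit.
Unset Printing Implicit Defensive.

Import GRing.Theory.
Local Open Scope ring_scope.
Local Open Scope classical_set_scope.

(* 'Z_m is the ring of integers modulo m only for m >= 2; here m = 2 ^ e with
   e positive. *)
Definition residue (e : nat) (a : int) : 'Z_(2 ^ e) := a%:~R.

(* The entry at position k : 'I_e.-1 is the residue class of a_(k+2). *)
Definition residue_tuple (e : nat) (a : nat -> int) : (e.-1).-tuple 'Z_(2 ^ e) :=
  [tuple residue e (a k.+2) | k < e.-1].

(* The coefficient of x ^ (n - i) in det (x I - M); subtraction on nat is
   truncated, so i > n has to be treated separately. *)
Definition charcoef (n : nat) (M : 'M[int]_n) (i : nat) : int :=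
  if (i <= n)%N then (char_poly M)`_(n - i) else 0.

Definition sfU (n : nat) : set 'M[int]_n :=
  [set M | (forall i j, M i j = 1 \/ M i j = -1) /\ (forall i, M i i = 1)].

Definition calC (e n : nat) (Mn : set 'M[int]_n) : set ((e.-1).-tuple 'Z_(2 ^ e)) :=
  [set residue_tuple e (charcoef M) | M in Mn].
Arguments calC e {n} Mn _.
Arguments sfU n _ : clear implicits.

(* Main.v *)
Require Import Defs.
From mathcomp Require Import all_boot all_algebra.
From mathcomp Require Import boolp classical_sets.
From mathcomp Require Import zify ring.

Set Implicit Arguments.
Unset Strict Implicit.
Unset Printing Implicit Defensive.

Import GRing.Theory.
Local Open Scope ring_scope.
Local Open Scope classical_set_scope.

(* Write M = J - 2B, with J the all-ones matrix and B a 0/1 matrix with zero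
   diagonal. Bordering x I + 2B by all-ones vectors shows that 2^(i-1) divides
   a_i. If B is the adjacency matrix of an acyclic digraph, the same determinant
   gives a_i = - (-2)^(i-1) w_(i-1), where w_k is the number of walks with k
   edges. It remains to prescribe w_1, ..., w_(e-1) modulo 2^e: a directed path
   with m edges has w_m = 1 and w_k = 0 for k > m, so disjoint unions of such
   paths, padded with isolated vertices, solve a unitriangular system. *)

(** * Determinants bordered by ones *)

Lemma coef_comp_scaleX (R : comNzRingType) (p : {poly R}) (a : R) (k : nat) :
  (p \Po (a *: 'X))`_k = p`_k * a ^+ k.
Proof.
rewrite coef_comp_poly.
under eq_bigr => i _ do rewrite exprZn coefZ coefXn.
have [lt_k|le_k] := ltnP k (size p).
  rewrite (bigD1 (Ordinal lt_k)) //= eqxx mulr1 big1 ?addr0 // => i ne_i.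
  by rewrite (negPf (_ : k != i)) ?mulr0 // eq_sym.
rewrite nth_default // mul0r big1 // => i _.
by rewrite (_ : (k == i) = false) ?mulr0 //; have := ltn_ord i; lia.
Qed.

Definition bordered (R : nzRingType) (n : nat) (A : 'M[R]_n) : 'M[R]_(n + 1) :=
  block_mx A (const_mx 1) (const_mx 1) 2%:M.

(* Both sides are twice the determinant of [[2A, u], [v, 1]], with [u] and [v]
   all-ones vectors. *)
Lemma det_double_sub_const1 (R : comNzRingType) (n : nat) (A : 'M[R]_n) :
  2 * \det (2 *: A - const_mx 1) = 2 ^+ n * \det (bordered A).
Proof.
pose u : 'cV[R]_n := const_mx 1; pose v : 'rV[R]_n := const_mx 1.
have uvE : u *m v = const_mx 1.
  by apply/matrixP => i j; rewrite mxE big_ord1 !mxE mulr1.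
have E1 : block_mx (2 *: A) u v 1%:M *m block_mx 1%:M 0 (- v) 1%:M
        = block_mx (2 *: A - const_mx 1) u 0 1%:M.
  rewrite mulmx_block !mulmx1 !mulmx0 !mul1mx mulmxN uvE !add0r.
  by rewrite addrN.
have E2 : block_mx (2 *: A) u v 1%:M *m block_mx 1%:M 0 0 2%:M
        = block_mx 2%:M 0 0 1%:M *m bordered A.
  rewrite !mulmx_block !mulmx1 !mulmx0 !mul0mx !mul1mx !addr0 !add0r.
  by rewrite !mul_scalar_mx mul_mx_scalar.
move/(congr1 determinant): E1.
rewrite det_mulmx det_lblock det_ublock !det1 !mulr1 => <-.
move/(congr1 determinant): E2.
rewrite !det_mulmx !det_ublock !det1 !det_scalar expr1.
by rewrite mul1r mulr1 => <-; rewrite mulrC.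
Qed.

(** Replacing ['X] by [2 *: 'X] turns the characteristic matrix into twice ['X%:M + B] minus the
    all-ones matrix, so the bordering identity applies. Comparing coefficients of ['X^(n - i)] then
    cancels [2 ^+ (n - i).+1] from [2 ^+ n]. *)
Lemma char_poly_const1_sub_double (n : nat) (B : 'M[int]_n) (i : nat) :
  (0 < i <= n)%N ->
  (char_poly (const_mx 1 - 2 *: B))`_(n - i) =
  2 ^+ i.-1 * (\det (bordered ('X%:M + map_mx polyC B)))`_(n - i).
Proof.
case/andP=> i_gt0 le_in; set M := _ - _; set Q := \det _.
have E : 2 * (char_poly M \Po (2 *: 'X)) = 2 ^+ n * Q.
  rewrite -det_double_sub_const1 /char_poly -[_ \Po _]/(comp_poly _ _) -det_map_mx.
  congr (_ * \det _); apply/matrixP => r c; rewrite !mxE.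
  rewrite !rmorphB !rmorphMn /= comp_polyX comp_polyC.
  rewrite comp_polyC polyCM -!mul_polyC (rmorph_nat polyC); ring.
have n2 : (2 : int) ^+ (n - i).+1 != 0 by rewrite expf_neq0.
apply: (mulfI n2); rewrite mulrA -exprD.
have -> : ((n - i).+1 + i.-1 = n)%N by lia.
move/(congr1 (fun p : {poly int} => p`_(n - i))): E.
have C m (p : {poly int}) k : (2 ^+ m * p)`_k = 2 ^+ m * p`_k.
  by rewrite -(rmorph_nat polyC) -rmorphXn coefCM.
by rewrite -[2 * _]/(2 ^+ 1 * _) !C coef_comp_scaleX expr1 => <-;
  rewrite exprS -mulrA [X in _ * X]mulrC.
Qed.

(** * Windows of ones in a bit sequence *)

Definition all_ones (s : seq bool) (i k : nat) : bool :=
  all (nth false s) (iota i k).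

Definition ones_count (s : seq bool) (k : nat) : nat :=
  (\sum_(i < size s) all_ones s i k)%N.

Lemma all_onesS s i k : all_ones s i k.+1 = nth false s i && all_ones s i.+1 k.
Proof. by []. Qed.

Lemma all_ones_cons b s i k : all_ones (b :: s) i.+1 k = all_ones s i k.
Proof. by rewrite /all_ones -[i.+1]add1n iotaDl all_map. Qed.

(** The default [false] of [nth] keeps a nonempty window of ones inside [s]. *)
Lemma all_ones_size s i k : (0 < k)%N -> all_ones s i k -> (i + k <= size s)%N.
Proof.
case: k => // k _ /allP /(_ (i + k)%N).
rewrite mem_iota => H; have : nth false s (i + k) by apply: H; lia.
by rewrite addnS; case: (ltnP (i + k) (size s)) => // le; rewrite nth_default.
Qed.

Lemma sum_all_ones n s k : (size s <= n)%N -> (0 < k)%N ->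
  (\sum_(i < n) all_ones s i k)%N = ones_count s k.
Proof.
move=> le_sn k_gt0.
rewrite /ones_count [RHS](big_ord_widen n (fun i => all_ones s i k : nat)) //.
rewrite [RHS]big_mkcond; apply: eq_bigr => i _.
case: ifP => // /negbT nlt; case: (boolP (all_ones s i k)) => //.
by move/(all_ones_size k_gt0); lia.
Qed.

Lemma ones_count_cons b s k :
  ones_count (b :: s) k = (all_ones (b :: s) 0 k + ones_count s k)%N.
Proof.
rewrite /ones_count big_ord_recl; congr addn.
by apply: eq_bigr => i _; rewrite all_ones_cons.
Qed.

Lemma all_ones_block m s k : all_ones (nseq m true ++ false :: s) 0 k = (k <= m)%N.
Proof.
elim: m k => [|m IHm] [|k] //=.
by rewrite all_onesS /= all_ones_cons IHm.
Qed.

(** The closing [false] stops windows from crossing into [s]; truncated subtraction gives 0 when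
    [m < k]. *)
Lemma ones_count_block m s k : (0 < k)%N ->
  ones_count (nseq m true ++ false :: s) k = (m.+1 - k + ones_count s k)%N.
Proof.
move=> k_gt0; elim: m => [|m IHm].
  rewrite ones_count_cons (all_ones_block 0 s k); lia.
rewrite [nseq _ _ ++ _]/= ones_count_cons IHm (all_ones_block m.+1 s k); lia.
Qed.

Lemma ones_count_blocks m x s k : (0 < k)%N ->
  ones_count (iter x (fun t => nseq m true ++ false :: t) s) k =
  (x * (m.+1 - k) + ones_count s k)%N.
Proof.
move=> k_gt0; elim: x => // x IHx.
by rewrite iterS ones_count_block // IHx; lia.
Qed.

(* Blocks of exactly [k] ones contribute [1] to the count of length [k] and
   nothing to longer ones, so the counts are prescribed from the longest down. *)
Lemma ones_count_surj (p K : nat) :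
  exists N, forall f : nat -> 'I_p.+2, exists s : seq bool,
    [/\ (size s <= N)%N,
        forall k, (0 < k <= K)%N -> (ones_count s k)%:R = f k
      & forall k, (K < k)%N -> ones_count s k = 0%N].
Proof.
elim: K => [|K [N IH]].
  exists 0%N => f; exists [::]; split=> // k; last by rewrite /ones_count big_ord0.
  by case: k.
exists (p.+2 * K.+2 + N)%N => f.
(* The targets for [s] discount in advance the [K.+2 - k] windows of length [k] in each of the
   [f K.+1] new blocks. *)
have [s [le_s s_f s_0]] :=
  IH (fun k => f k - ((f K.+1 : nat) * (K.+2 - k))%N%:R).
exists (iter (f K.+1) (fun t => nseq K.+1 true ++ false :: t) s); split.
- have: (f K.+1 <= p.+2)%N by apply: ltnW.
  move: (nat_of_ord _) => x le_x.
  have -> : size (iter x (fun t => nseq K.+1 true ++ false :: t) s)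
            = (x * K.+2 + size s)%N.
    by elim: {le_x} x => // x IHx; rewrite iterS size_cat size_nseq /= IHx; lia.
  by rewrite leq_add // leq_mul2r le_x orbT.
- move=> k /andP[k_gt0 le_k]; rewrite ones_count_blocks // natrD.
  case: (ltnP K k) => [lt_k | le_kK]; last by rewrite s_f ?k_gt0 // addrC subrK.
  have -> : k = K.+1 by lia.
  by rewrite s_0 // addr0 subSnn muln1 natr_Zp.
- move=> k lt_k; rewrite ones_count_blocks ?s_0; lia.
Qed.

(** * Bordered determinants of path digraphs *)

(* Adjacency matrix of the subgraph of the path 0 -> 1 -> ... -> n-1 that keeps
   the edge i -> i+1 iff bit i of [s] is set; walks with k edges are then the
   windows of k consecutive ones in [s]. *)
Definition path_mx (s : seq bool) (n : nat) : 'M[int]_n :=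
  \matrix_(i, j) ((j == i.+1 :> nat) && nth false s i)%:R.

Definition ones_col (s : seq bool) (n k : nat) : 'cV[int]_n :=
  \col_i (all_ones s i k)%:R.

Lemma path_mx_ones_col s n k : (size s < n)%N ->
  path_mx s n *m ones_col s n k = ones_col s n k.+1.
Proof.
move=> lt_sn; apply/matrixP => i j; rewrite !mxE all_onesS.
under eq_bigr => l _ do rewrite !mxE.
have [lt_i|le_i] := ltnP i.+1 n.
  rewrite (bigD1 (Ordinal lt_i)) //= eqxx andTb -natrM mulnb big1 ?addr0 // => l ne_l.
  by rewrite (_ : (_ == _) = false) ?mul0r //; apply: negPf.
(* In the last row there is no column [i.+1], but [size s < n] makes bit [i] equal to [false]. *)
rewrite [nth _ _ _]nth_default; last by lia.
by rewrite big1 // => l _; rewrite andbF mul0r.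
Qed.

(* [m = n] gives X^n (X I + B)^-1 u, the Neumann series being finite. *)
Definition resolvent_col (s : seq bool) (n m : nat) : 'cV[{poly int}]_n :=
  \sum_(k < m) ((-1) ^+ k * 'X^(m.-1 - k)) *: map_mx polyC (ones_col s n k).

Lemma resolvent_colS s n m : resolvent_col s n m.+1 =
  'X *: resolvent_col s n m + (-1) ^+ m *: map_mx polyC (ones_col s n m).
Proof.
rewrite /resolvent_col big_ord_recr /= subnn expr0 mulr1; congr (_ + _).
rewrite scaler_sumr; apply: eq_bigr => k _; rewrite scalerA; congr (_ *: _).
rewrite mulrCA -exprS; congr (_ * 'X^_); have := ltn_ord k; lia.
Qed.

Lemma resolvent_colP s n m : (size s < n)%N ->
  ('X%:M + map_mx polyC (path_mx s n)) *m resolvent_col s n m =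
  'X^m *: const_mx 1 - (-1) ^+ m *: map_mx polyC (ones_col s n m).
Proof.
move=> lt_sn; elim: m => [|m IHm].
  rewrite /resolvent_col big_ord0 mulmx0 !expr0 !scale1r.
  by apply/esym/eqP; rewrite subr_eq0; apply/eqP/matrixP => i j; rewrite !mxE.
rewrite resolvent_colS mulmxDr -!scalemxAr IHm mulmxDl mul_scalar_mx.
rewrite -map_mxM path_mx_ones_col // !exprS.
apply/matrixP => i j; rewrite !mxE; ring.
Qed.

Lemma det_bordered_path s n : (size s < n)%N ->
  \det (bordered ('X%:M + map_mx polyC (path_mx s n))) =
  2 * 'X^n - \sum_i resolvent_col s n n i 0.
Proof.
move=> lt_sn; set A := _ + _; set c := resolvent_col s n n.
have cE : A *m c = 'X^n *: const_mx 1.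
  rewrite resolvent_colP //; set z := map_mx _ _.
  (* A window of [n] ones does not fit in [s], so the remainder vanishes. *)
  suff -> : z = 0 by rewrite scaler0 subr0.
  apply/matrixP => i j; rewrite !mxE; case: (boolP (all_ones _ _ _)) => //=.
  by move/all_ones_size; lia.
have detA : \det A = 'X^n.
  rewrite -det_tr det_trig.
    rewrite (eq_bigr (fun=> 'X)) ?prodr_const ?card_ord // => i _.
    by rewrite !mxE eqxx (_ : (_ == _) = false) ?addr0 //; lia.
  apply/is_trig_mxP => i j lt_ij; rewrite !mxE.
  have -> : (j == i) = false by apply: negbTE; rewrite neq_ltn lt_ij orbT.
  have -> : (i == j.+1 :> nat) = false by lia.
  by rewrite addr0.
(* Column elimination of the border, with the last column scaled by ['X^n] to stay within
   polynomials. *)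
have E : bordered A *m block_mx 1%:M (- c) 0 ('X^n)%:M =
    block_mx A 0 (const_mx 1) (2 * 'X^n - \sum_i c i 0)%:M.
  rewrite mulmx_block !mulmx1 !mulmx0 !addr0 !mulmxN cE.
  rewrite mul_mx_scalar addNr; congr block_mx.
  apply/matrixP => i j; rewrite !ord1 mul_mx_scalar !mxE.
  rewrite !mulr1n [RHS]addrC mulrC; congr (- _ + _).
  by apply: eq_bigr => k _; rewrite mxE mul1r.
have nX : 'X^n != 0 :> {poly int} by rewrite -size_poly_eq0 size_polyXn.
move/(congr1 determinant): E.
rewrite det_mulmx det_ublock det_lblock det1 mul1r !det_scalar !expr1 detA.
by rewrite mulrC => /(mulfI nX).
Qed.

Lemma charcoef_path s n k : (size s < n)%N -> (0 < k < n)%N ->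
  charcoef (const_mx 1 - 2 *: path_mx s n) k.+1 =
  2 ^+ k * ((-1) ^+ k.+1 * (ones_count s k)%:R).
Proof.
move=> lt_sn /andP[k_gt0 lt_kn].
rewrite /charcoef lt_kn char_poly_const1_sub_double //; congr (_ * _).
rewrite det_bordered_path // coefB coef_sum.
rewrite -(rmorph_nat polyC) coefCM coefXn (_ : (_ == n) = false); last by lia.
rewrite mulr0 sub0r exprS mulN1r mulNr; congr (- _).
rewrite -(@sum_all_ones n) // 1?ltnW // natr_sum mulr_sumr; apply: eq_bigr => i _.
(* Only the Neumann term of index [k] contributes in degree [n - k.+1]. *)
rewrite summxE coef_sum (bigD1 (Ordinal lt_kn)) //= big1 ?addr0.
  rewrite !mxE mulrC mulrA coefMXn.
  have -> : (n - k.+1 = n.-1 - k)%N by lia.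
  by rewrite ltnn subnn mulrC -(rmorphN1 polyC) -rmorphXn coefCM coefC.
move=> l ne_lk; rewrite !mxE mulrC mulrA coefMXn.
rewrite -(rmorphN1 polyC) -rmorphXn -rmorphM coefC.
have: (l != k :> nat) by [].
by have := ltn_ord l => *; case: ltnP => // ?; rewrite (_ : (_ == _) = false) //; lia.
Qed.

(** * The two inclusions *)

Lemma charcoef_dvd n (M : 'M[int]_n) i : sfU n M -> (0 < i)%N ->
  ((2 ^ (i - 1))%N%:Z %| charcoef M i)%Z.
Proof.
move=> [M1 _] i_gt0; rewrite /charcoef; case: leqP => [le_in|_]; last exact: dvdz0.
pose B : 'M[int]_n := \matrix_(r, c) (M r c == -1)%:R.
have -> : M = const_mx 1 - 2 *: B.
  by apply/matrixP => r c; rewrite !mxE; case: (M1 r c) => ->.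
rewrite char_poly_const1_sub_double ?i_gt0 // subn1 -natz natrX.
exact/dvdz_mulr/dvdzz.
Qed.

Lemma sfU_path s n : sfU n (const_mx 1 - 2 *: path_mx s n).
Proof.
split=> [i j|i]; rewrite !mxE; first by case: (_ && _); [right | left].
by rewrite (_ : (_ == _) = false) //; lia.
Qed.

Theorem theorem1p2 (e : nat) (e_gt0 : (0 < e)%N) :
  exists N : nat, forall n : nat, (N < n)%N ->
    calC e (sfU n) =
    [set residue_tuple e a | a in
      [set a : nat -> int |
        forall i : nat, (2 <= i <= e)%N -> ((2 ^ (i - 1))%N%:Z %| a i)%Z]].
Proof.
have [N HN] := ones_count_surj (Zp_trunc (2 ^ e)) e.
(* [N] bounds the length of [s]; the extra [e] keeps the indices in the range of [charcoef_path]. *)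
exists (N + e)%N => n lt_n; apply/seteqP; split=> t /=.
  move=> [M UM <-]; exists (charcoef M) => // i /andP[i_gt1 _].
  by apply: charcoef_dvd => //; lia.
move=> [a a_dvd <-].
pose b i := (a i %/ (2 ^ (i - 1))%N%:Z)%Z.
(* The sign in the target cancels the one in [charcoef_path]. *)
have [s [le_s s_f _]] := HN (fun k => ((-1) ^+ k.+1 * b k.+1)%:~R).
exists (const_mx 1 - 2 *: path_mx s n); first exact: sfU_path.
apply: eq_from_tnth => k; rewrite !tnth_mktuple /residue.
have lt_k := ltn_ord k.
rewrite charcoef_path; [|lia..].
have -> : a k.+2 = 2 ^+ k.+1 * b k.+2.
  rewrite -[LHS](@divzK (2 ^ (k.+2 - 1))%N%:Z); last by apply: a_dvd; lia.
  by rewrite mulrC -/(b _) subn1 -natz natrX.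
rewrite [LHS]intrM [RHS]intrM; congr (_ * _).
rewrite intrM rmorph_nat s_f; last by lia.
by rewrite -intrM mulrA -exprMn mulrNN mulr1 expr1n mul1r.
Qed.
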